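(* The energy barriers between the monochromatic configurations $\mathbf 1,\mathbf 2,\mathbf 3$ are given by \[ \Gamma(\mathbf 1,\mathbf 3)=\Gamma(\mathbf 1,\mathbf 2)=\Gamma_{13}^\star,\qquad \Gamma(\mathbf 2,\mathbf 3)=\Gamma_{23}^\star . \]
   Context: Let $K,L$ be positive integers and let $(V,E)$ be the $K\times L$ rectangular lattice graph with periodic boundary conditions: $V=(\mathbb Z/K\mathbb Z)\times(\mathbb Z/L\mathbb Z)$ and $E$ is the set of nearest-neighbour edges. Let $0<h_1<h_2<h_3<1$ be real numbers. Standing assumptions: (A) $K$ and $L$ are both greater than $\frac{3}{h_3-h_2}$ and greater than $\frac{3}{h_2-h_1}$; (B) $a(h_2-h_1)+b(h_3-h_2)\notin\mathbb Z$ for all $(a,b)\in\mathbb Z^2\setminus\{(0,0)\}$. The configuration space is $\mathcal X=\{1,2,3\}^V$, with Hamiltonian \[ H(\sigma)=-\sum_{\{x,y\}\in E}\mathbf 1_{\{\sigma(x)=\sigma(y)\}}-\sum_{x\in V}h_{\sigma(x)} . \] For $i\in\{1,2,3\}$, $\mathbf i\in\mathcal X$ is the configuration with constant spin $i$. Two configurations are adjacent, $\sigma\sim\eta$, if they differ at exactly one site. A path from $\sigma$ to $\eta$ is a finite sequence $\omega_0=\sigma,\omega_1,\dots,\omega_T=\eta$ with $\omega_t\sim\omega_{t+1}$. The communication height $\Phi(\sigma,\eta)$ is the minimum over all paths from $\sigma$ to $\eta$ of $\max_t H(\omega_t)$, and the energy barrier is $\Gamma(\sigma,\eta)=\Phi(\sigma,\eta)-H(\sigma)$.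 For $h\in(0,1)$ let $f(h)=4\ell_c-h(\ell_c(\ell_c-1)+1)$ with $\ell_c=\lceil 2/h\rceil$. For $1\le i<j\le 3$ set $\Gamma_{ij}^\star=f(h_j-h_i)$. *)

(* Defs.v *)
From mathcomp Require Import all_boot all_order all_algebra.
From mathcomp Require Import boolp classical_sets reals.
Set Implicit Arguments.
Unset Strict Implicit.
Unset Printing Implicit Defensive.
Import Order.TTheory GRing.Theory Num.Theory.
Local Open Scope ring_scope.

(* The spin values 1, 2, 3 are the ordinals 0, 1, 2. *)
Notation spin := 'I_3 (only parsing).
Definition spin1 : spin := @Ordinal 3 0 isT.
Definition spin2 : spin := @Ordinal 3 1 isT.
Definition spin3 : spin := @Ordinal 3 2 isT.

(* [ordS] is the cyclic successor on 'I_n, so 'I_K * 'I_L is the vertex set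
   (Z/K) x (Z/L) also when K or L is smaller than 2. *)
Notation torus K L := ('I_K * 'I_L)%type (only parsing).

Definition cyclic_nbr n (i j : 'I_n) : bool := (j == ordS i) || (i == ordS j).

Definition torus_adj K L (x y : torus K L) : bool :=
  (x != y) &&
  ((x.1 == y.1) && cyclic_nbr x.2 y.2 || (x.2 == y.2) && cyclic_nbr x.1 y.1).

Definition edges K L : {set {set torus K L}} :=
  [set e | [exists x, exists y, torus_adj x y && (e == [set x; y])]].

Notation config K L := {ffun torus K L -> spin} (only parsing).

Definition mono K L (i : spin) : config K L := [ffun=> i].

(* For e = {x, y}: sigma x = sigma y. *)
Definition agree_on K L (sigma : config K L) (e : {set torus K L}) : bool :=
  [forall x in e, forall y in e, sigma x == sigma y].

Definition config_adj K L (sigma eta : config K L) : bool :=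
  #|[set x | sigma x != eta x]| == 1%N.

(* A path omega_0, ..., omega_T from sigma to eta is encoded by the sequence
   [omega_1; ...; omega_T], with omega_0 = sigma; T = 0 is allowed. *)
Definition is_path K L (sigma eta : config K L) (p : seq (config K L)) : Prop :=
  path (@config_adj K L) sigma p /\ last sigma p = eta.

Definition hamiltonian (R : realType) (K L : nat) (h : spin -> R)
    (sigma : config K L) : R :=
  - (\sum_(e in edges K L) (agree_on sigma e)%:R)
  - \sum_(x : torus K L) h (sigma x).

Definition path_height (R : realType) (K L : nat) (h : spin -> R)
    (sigma : config K L) (p : seq (config K L)) : R :=
  \big[Num.max/hamiltonian h sigma]_(omega <- p) hamiltonian h omega.

(* This infimum is a minimum: see [comm_height_is_min]. *)
Definition comm_height (R : realType) (K L : nat) (h : spin -> R)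
    (sigma eta : config K L) : R :=
  inf [set v | exists2 p, is_path sigma eta p & v = path_height h sigma p]%classic.

Definition energy_barrier (R : realType) (K L : nat) (h : spin -> R)
    (sigma eta : config K L) : R :=
  comm_height h sigma eta - hamiltonian h sigma.

Lemma is_path_exists K L (sigma eta : config K L) : exists p, is_path sigma eta p.
Proof.
have [n] := ubnP #|[set x | sigma x != eta x]|.
elim: n sigma => // n IHn sigma le_n.
have [d0|[x]] := set_0Vmem [set x | sigma x != eta x].
  exists [::]; split => //=; apply/ffunP => x; apply/eqP.
  by have := finset.in_set0 x; rewrite -d0 inE => /negbFE.
rewrite inE => nx.
pose tau : config K L := [ffun y => if y == x then eta y else sigma y].
have [|p [pp lp]] := IHn tau.
  rewrite -ltnS (leq_trans _ le_n) // ltnS; apply: proper_card.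
  apply/fintype.properP; split.
    by apply/fintype.subsetP => y; rewrite !inE ffunE; case: (y == x); rewrite ?eqxx.
  by exists x; rewrite !inE ?ffunE ?eqxx.
exists (tau :: p); split => //=; rewrite pp andbT /config_adj.
apply/cards1P; exists x; apply/finset.setP => y; rewrite !inE ffunE.
by case: (eqVneq y x) => [->|]; rewrite ?eqxx.
Qed.

Lemma path_height_attained (R : realType) (K L : nat) (h : spin -> R)
    (sigma : config K L) p :
  exists omega : config K L, path_height h sigma p = hamiltonian h omega.
Proof.
rewrite /path_height; elim: p => [|c p [w IHp]]; first by exists sigma; rewrite big_nil.
rewrite big_cons IHp; case: leP => _; [by exists w | by exists c].
Qed.

Lemma comm_height_is_min (R : realType) (K L : nat) (h : spin -> R)
    (sigma eta : config K L) :
  (exists2 p, is_path sigma eta p & path_height h sigma p = comm_height h sigma eta)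
  /\ (forall p, is_path sigma eta p -> comm_height h sigma eta <= path_height h sigma p).
Proof.
pose P (w : config K L) := `[< exists2 p, is_path sigma eta p
                 & path_height h sigma p = hamiltonian h w >].
have [p0 pp0] := is_path_exists sigma eta.
have [w0 pw0] := path_height_attained h sigma p0.
have Pw0 : P w0 by apply/asboolP; exists p0.
case: (Order.TotalTheory.arg_minP (fun w : config K L => hamiltonian h w) Pw0) => w /asboolP[p pp pw] wmin.
have lbw q : is_path sigma eta q -> hamiltonian h w <= path_height h sigma q.
  move=> pq; have [v pv] := path_height_attained h sigma q; rewrite pv.
  by apply: wmin; apply/asboolP; exists q.
suff -> : comm_height h sigma eta = hamiltonian h w by split => //; exists p.
apply/eqP; rewrite eq_le; apply/andP; split.
  apply: ge_inf; last by exists p.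
  by exists (hamiltonian h w) => _ [q pq ->]; exact: lbw.
apply: lb_le_inf; first by exists (path_height h sigma p), p.
by move=> _ [q pq ->]; exact: lbw.
Qed.

Definition crit_length (R : realType) (d : R) : int := Num.ceil (2 / d).

Definition crit_energy (R : realType) (d : R) : R :=
  let l : R := (crit_length d)%:~R in 4 * l - d * (l * (l - 1) + 1).

Definition Gamma_star (R : realType) (h : spin -> R) (i j : spin) : R :=
  crit_energy (h j - h i).

(* Main.v *)
(* For two spins i, j with h_j - h_i = d, the excess energy of a droplet of j in a sea
   of i is its perimeter minus d times its area.

   Lower bound: let a and b be the numbers of columns and rows that meet the droplet, and
   let l = ceil (2 / d).  Look at the first time when a + b >= 2 l, a > l or b > l.  The
   droplet cannot wrap around the torus yet, so its perimeter is at least 2 (a + b), while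
   its area exceeds by at most one that of a box with half-perimeter < 2 l and sides <= l.
   This forces the excess energy to be at least 4 l - d (l (l - 1) + 1).  Merging spins
   only lowers the energy, so it suffices to follow the droplet of spins other than 1
   (paths from 1), or of spins 3 (paths from 2 to 3).

   Upper bound: grow quasi-squares up to l x l, then a strip of width l, then the torus,
   one line at a time and each line site by site; a staircase shape meeting a columns and
   b rows has perimeter at most 2 (a + b).  From 1 to 2 it is cheapest to pass through 3:
   assumption (A) makes the bulk energy gained between 1 and 2 exceed the barrier
   Gamma_23, so the second half of this path stays below the energy of 1. *)
Require Import Defs.
From mathcomp Require Import all_boot all_order all_algebra.
From mathcomp Require Import reals.
From mathcomp Require Import zify ring lra.
Set Implicit Arguments.
Unset Strict Implicit.
Unset Printing Implicit Defensive.
Import Order.TTheory GRing.Theory Num.Theory.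
Local Open Scope ring_scope.

(** * Edges of the torus, and the Hamiltonian as a count of disagreements *)

Definition right_of K L (x : 'I_K * 'I_L) : 'I_K * 'I_L := (ordS x.1, x.2).
Definition above K L (x : 'I_K * 'I_L) : 'I_K * 'I_L := (x.1, ordS x.2).

Lemma val_ordS n (i : 'I_n) :
  ordS i = (if i.+1 == n then 0 else i.+1) :> nat.
Proof.
rewrite /=; case: eqP => [->|ne]; first by rewrite modnn.
by rewrite modn_small //; have := ltn_ord i; lia.
Qed.

Lemma ordS_neq n (i : 'I_n) : (1 < n)%N -> ordS i != i.
Proof.
move=> n1; apply/eqP => /(congr1 val)/=; rewrite [X in X = _]val_ordS.
by case: eqP; lia.
Qed.

Lemma ordS2_neq n (i : 'I_n) : (2 < n)%N -> ordS (ordS i) != i.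
Proof.
move=> n1; apply/eqP => /(congr1 val)/=; rewrite -[X in X = _]/(val (ordS (ordS i))).
by rewrite [X in X = _]val_ordS val_ordS; have := ltn_ord i; do 2?case: eqP; lia.
Qed.

Lemma set2_inj (T : finType) (x y z t : T) :
  [set x; y] = [set z; t] -> (x = z /\ y = t) \/ (x = t /\ y = z).
Proof.
move=> E.
have : x \in [set z; t] by rewrite -E !inE eqxx.
have : y \in [set z; t] by rewrite -E !inE eqxx orbT.
have : z \in [set x; y] by rewrite E !inE eqxx.
have : t \in [set x; y] by rewrite E !inE eqxx orbT.
rewrite !inE.
by do 4 (case/orP => /eqP ?); subst; auto.
Qed.

(** Two such edges could coincide only with exchanged endpoints, that is if [ordS (ordS i) = i];
    this happens for K = 2 but not for K > 2. *)
Lemma right_edge_inj K L : (2 < K)%N ->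
  injective (fun x : 'I_K * 'I_L => [set x; right_of x]).
Proof.
move=> K2 [i j] [i' j'] /set2_inj [[] //|] [[-> _] [/eqP]].
by rewrite (negbTE (ordS2_neq _ K2)).
Qed.

Lemma above_edge_inj K L : (2 < L)%N ->
  injective (fun x : 'I_K * 'I_L => [set x; above x]).
Proof.
move=> K2 [i j] [i' j'] /set2_inj [[] //|] [[_ ->] [_ /eqP]].
by rewrite (negbTE (ordS2_neq _ K2)).
Qed.

Lemma right_above_edge_neq K L (x y : 'I_K * 'I_L) : (2 < K)%N ->
  [set x; right_of x] <> [set y; above y].
Proof.
case: x y => [i j] [i' j'] K2 /set2_inj; rewrite /right_of /above /=.
have K1 : (1 < K)%N by lia.
by case=> [[[-> _] [/eqP]]|[[-> _] [/eqP]]]; rewrite (negbTE (ordS_neq _ K1)).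
Qed.

Lemma edgesE K L : (2 < K)%N -> (2 < L)%N ->
  edges K L = [set [set x; right_of x] | x in [set: 'I_K * 'I_L]]
          :|: [set [set x; above x] | x in [set: 'I_K * 'I_L]].
Proof.
move=> K2 L2; have K1 : (1 < K)%N by lia. have L1 : (1 < L)%N by lia.
apply/setP => e; rewrite !inE; apply/existsP/orP.
  move=> [[i j] /existsP[[i' j'] /andP[/andP[_ /= H] /eqP ->]]].
  move: H => /orP[] /andP[/eqP <-] /orP[] /eqP ->; [right|right|left|left].
  - by apply/imsetP; exists (i, j); rewrite ?inE.
  - by apply/imsetP; exists (i, j'); rewrite ?inE // setUC.
  - by apply/imsetP; exists (i, j); rewrite ?inE.
  - by apply/imsetP; exists (i', j); rewrite ?inE // setUC.
case=> /imsetP[[i j] _ ->].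
  exists (i, j); apply/existsP; exists (ordS i, j).
  rewrite /torus_adj /cyclic_nbr /= !eqxx !orbT !andbT.
  by apply/eqP => -[/esym/eqP]; rewrite (negbTE (ordS_neq _ K1)).
exists (i, j); apply/existsP; exists (i, ordS j).
rewrite /torus_adj /cyclic_nbr /= !eqxx !andbT.
by apply/eqP => -[/esym/eqP]; rewrite (negbTE (ordS_neq _ L1)).
Qed.

Lemma sum_edges K L (R : nmodType) (g : {set 'I_K * 'I_L} -> R) :
  (2 < K)%N -> (2 < L)%N ->
  \sum_(e in edges K L) g e
    = \sum_x (g [set x; right_of x] + g [set x; above x]).
Proof.
move=> K2 L2; rewrite edgesE // big_split /=.
set A := [set _ | _ in _]; set B := [set [set _; above _] | _ in _].
have dAB : [disjoint A & B].
  rewrite disjoints_subset; apply/subsetP => _ /imsetP[x _ ->].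
  by rewrite inE; apply/negP => /imsetP[y _]; exact: right_above_edge_neq.
rewrite (eq_bigl (mem [predU A & B])) => [|e]; last by rewrite !inE.
rewrite bigU //=.
rewrite !big_imset /=; first last.
- by move=> x y _ _; apply: right_edge_inj.
- by move=> x y _ _; apply: above_edge_inj.
by congr (_ + _); apply: eq_bigl => x; rewrite inE.
Qed.

Lemma agree_on_pair K L (sigma : {ffun 'I_K * 'I_L -> 'I_3}) x y :
  agree_on sigma [set x; y] = (sigma x == sigma y).
Proof.
apply/forall_inP/idP => [|/eqP E z].
  by move/(_ x); rewrite !inE eqxx => /(_ isT)/forall_inP/(_ y); rewrite !inE eqxx orbT => /(_ isT).
rewrite !inE => /orP[]/eqP->; apply/forall_inP => t; rewrite !inE => /orP[]/eqP->; by rewrite ?E.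
Qed.

(** For K, L > 2 every edge is counted once, so for boolean [s] this is the perimeter of the droplet
    where [s] holds. *)
Definition disagreements K L (T : eqType) (s : 'I_K * 'I_L -> T) : nat :=
  (\sum_x ((s x != s (right_of x)) + (s x != s (above x))))%N.

Lemma hamiltonian_sub_mono (R : realType) K L (h : 'I_3 -> R)
    (sigma : {ffun 'I_K * 'I_L -> 'I_3}) (i : 'I_3) :
  (2 < K)%N -> (2 < L)%N ->
  hamiltonian h sigma - hamiltonian h (mono K L i)
    = (disagreements sigma)%:R - \sum_x (h (sigma x) - h i).
Proof.
move=> K2 L2; rewrite /hamiltonian !sum_edges // /disagreements natr_sum sumrB.
under [in X in _ - X = _]eq_bigr do rewrite !agree_on_pair !ffunE eqxx.
under [X in _ - (_ - X) = _]eq_bigr do rewrite ffunE.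
under [X in - X - _ - _ = _]eq_bigr do rewrite !agree_on_pair.
set a := \sum_ _ _; set b := \sum_ _ _; set c := \sum_ _ _; set e := \sum_ _ _.
set f := \sum_ _ _.
suff -> : f = c - a by ring.
rewrite /f /c /a -sumrB; apply: eq_bigr => x _.
by rewrite natrD; do 2 case: eqP => _ /=; ring.
Qed.

(** * Perimeter bounds, line by line *)

Definition cyclic_changes (T : eqType) n (s : 'I_n -> T) : nat :=
  (\sum_i (s i != s (ordS i)))%N.

Lemma disagreementsE (T : eqType) K L (s : 'I_K * 'I_L -> T) :
  disagreements s = (\sum_j cyclic_changes (fun i => s (i, j))
                     + \sum_i cyclic_changes (fun j => s (i, j)))%N.
Proof.
rewrite /disagreements big_split /=; congr addn; last by rewrite pair_bigA; apply: eq_bigr; case.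
by rewrite exchange_big pair_bigA; apply: eq_bigr; case.
Qed.

Lemma ordS_invariant n (P : pred 'I_n) i j :
  (forall k, P k -> P (ordS k)) -> P i -> P j.
Proof.
move=> PS Pi; have Pit k : P (iter k (@ordS n) i) by elim: k => //= k; apply: PS.
have vit k : iter k (@ordS n) i = ((i + k) %% n)%N :> nat.
  elim: k => [|k IH]; first by rewrite addn0 modn_small.
  by rewrite [LHS]/= IH -addn1 modnDml -addnA addn1.
(* The summand n keeps the truncated subtraction exact when j < i and vanishes modulo n. *)
rewrite (_ : j = iter (j + n - i)%N (@ordS n) i) //; apply: val_inj; rewrite /= vit.
by rewrite subnKC ?modnDr ?modn_small //; have := ltn_ord i; lia.
Qed.

(** Going around the cycle, [s] must switch once from true to false and once back, at different
    positions. *)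
Lemma cyclic_changes_ge2 n (s : 'I_n -> bool) i j :
  s i -> ~~ s j -> (2 <= cyclic_changes s)%N.
Proof.
move=> si sj.
have [k /andP[sk skS]] : exists k, s k && ~~ s (ordS k).
  apply/existsP; apply: contraNT sj; rewrite negb_exists => /forallP H.
  by apply: ordS_invariant si => k sk; have := H k; rewrite sk negbK.
have [l /andP[sl slS]] : exists l, ~~ s l && s (ordS l).
  apply/existsP; apply: contraTT si; rewrite negb_exists => /forallP H.
  by apply: (@ordS_invariant _ (fun k => ~~ s k)) sj => l sl; have := H l; rewrite sl.
have kl : l != k by apply: contraNneq sl => ->.
rewrite /cyclic_changes (bigD1 k) //= (bigD1 l) //= sk (negbTE skS) (negbTE sl) slS.
lia.
Qed.

(** Some column misses A, so every row that meets A also has a point outside A and hence two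
    changes; likewise for columns. *)
Lemma disagreements_ge K L (A : {set 'I_K * 'I_L}) :
  (#|fst @: A| < K)%N -> (#|snd @: A| < L)%N ->
  (2 * (#|fst @: A| + #|snd @: A|) <= disagreements (fun x => x \in A))%N.
Proof.
move=> cK cL; rewrite disagreementsE addnC mulnDr; apply: leq_add.
  rewrite mulnC -sum_nat_const [leqRHS](bigID (mem (snd @: A))) /= -[leqLHS]addn0.
  apply: leq_add => //; apply: leq_sum => _ /imsetP[[i j] Aij ->] /=.
  have [i' ni'] : exists i', i' \notin fst @: A.
    apply/existsP; apply: contraLR cK; rewrite negb_exists => /forallP H.
    rewrite -leqNgt -[leqLHS](card_ord K) subset_leq_card //.
    by apply/subsetP => k _; have := H k; rewrite negbK.
  apply: (@cyclic_changes_ge2 _ _ i i') => //.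
  by apply: contra ni' => A'; apply/imsetP; exists (i', j).
rewrite mulnC -sum_nat_const [leqRHS](bigID (mem (fst @: A))) /= -[leqLHS]addn0.
apply: leq_add => //; apply: leq_sum => _ /imsetP[[i j] Aij ->] /=.
have [j' nj'] : exists j', j' \notin snd @: A.
  apply/existsP; apply: contraLR cL; rewrite negb_exists => /forallP H.
  rewrite -leqNgt -[leqLHS](card_ord L) subset_leq_card //.
  by apply/subsetP => k _; have := H k; rewrite negbK.
apply: (@cyclic_changes_ge2 _ _ j j') => //.
by apply: contra nj' => A'; apply/imsetP; exists (i, j').
Qed.

Lemma sum_ord_eq_le1 n (f : 'I_n -> nat) m :
  injective f -> (\sum_i (f i == m) <= 1)%N.
Proof.
move=> fI; rewrite -big_mkcond sum1_card; apply/card_le1_eqP => i j.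
by move=> /eqP fi /eqP fj; apply: fI; rewrite fi.
Qed.

(** A change can occur only at the end of the prefix or at the wrap-around from n - 1 to 0. *)
Lemma cyclic_changes_prefix n (s : 'I_n -> bool) m :
  (forall i, s i = (i < m)%N) -> (cyclic_changes s <= 2 * (0 < m))%N.
Proof.
move=> sE; case: m sE => [|m] sE.
  by rewrite muln0 leqn0 sum_nat_eq0; apply/forallP => i; rewrite !sE.
have H (i : 'I_n) : ((s i != s (ordS i)) <= ((i : nat) == m) + (i.+1 == n))%N.
  rewrite !sE val_ordS; have := ltn_ord i.
  by case: (i.+1 =P n) => _ iN; lia.
apply: (leq_trans (leq_sum _ (fun i _ => H i))); rewrite big_split /= muln1.
apply: (@leq_add _ _ 1 1); apply: sum_ord_eq_le1; first exact: val_inj.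
by move=> i j [] /val_inj.
Qed.

Lemma sum_ltn_ord n a : (\sum_(i < n) (i < a) = minn a n)%N.
Proof.
elim: n => [|n IH]; first by rewrite big_ord0 minn0.
by rewrite big_ord_recr /= IH; lia.
Qed.

(** [f] gives column heights and [g] row lengths: every line meets the set in a prefix, nonempty for
    at most a columns and b rows. *)
Lemma disagreements_staircase_le K L (s : 'I_K * 'I_L -> bool) (f g : nat -> nat) a b :
  (forall x, s x = (x.2 < f x.1)%N) -> (forall x, s x = (x.1 < g x.2)%N) ->
  (forall i, (0 < f i)%N -> (i < a)%N) -> (forall j, (0 < g j)%N -> (j < b)%N) ->
  (disagreements s <= 2 * (a + b))%N.
Proof.
move=> sf sg fa gb; rewrite disagreementsE addnC mulnDr; apply: leq_add.
  apply: (@leq_trans (\sum_(i < K) 2 * (0 < f i))).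
    by apply: leq_sum => i _; apply: cyclic_changes_prefix => j; rewrite sf.
  rewrite -big_distrr /= leq_mul2l /= (leq_trans _ (geq_minl a K)) // -sum_ltn_ord.
  by apply: leq_sum => i _; have := fa i; lia.
apply: (@leq_trans (\sum_(j < L) 2 * (0 < g j))).
  by apply: leq_sum => j _; apply: cyclic_changes_prefix => i; rewrite sg.
rewrite -big_distrr /= leq_mul2l /= (leq_trans _ (geq_minl b L)) // -sum_ltn_ord.
by apply: leq_sum => j _; have := gb j; lia.
Qed.

(** * Crossing the critical size and the lower bound *)

Lemma path_crossing (T : eqType) (e : rel T) (P : pred T) x p :
  path e x p -> ~~ P x -> P (last x p) ->
  exists y z, [/\ e y z, ~~ P y, P z & z \in p].
Proof.
elim: p x => [|y p IH] x /=; first by move=> _ /negbTE->.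
move=> /andP[exy pyp] nPx Pl; have [Py|nPy] := boolP (P y).
  by exists x, y; rewrite mem_head.
by have [z [t [? ? ? tp]]] := IH _ pyp nPy Pl; exists z, t; rewrite in_cons tp orbT.
Qed.

Lemma hamiltonian_le_path_height (R : realType) K L (h : 'I_3 -> R)
    (sigma omega : {ffun 'I_K * 'I_L -> 'I_3}) p :
  omega \in p -> hamiltonian h omega <= path_height h sigma p.
Proof.
rewrite /path_height; elim: p => // y p IH; rewrite in_cons big_cons le_max.
by case/orP => [/eqP->|/IH->]; rewrite ?lexx ?orbT.
Qed.

Definition droplet_energy (R : realType) (d : R) K L (s : 'I_K * 'I_L -> bool) : R :=
  (disagreements s)%:R - d * (\sum_x s x)%N%:R.

(** This is [crit_energy] with the length as a free natural number; they agree for l = ceil (2 /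
    d). *)
Definition critical_energy (R : realType) (d : R) (l : nat) : R :=
  4 * l%:R - d * (l%:R * (l%:R - 1) + 1).

(** The half-perimeter alone would let a thin droplet wrap around the torus; the side conditions
    stop it at length l + 1, still below K and L. *)
Definition supercritical K L l (A : {set 'I_K * 'I_L}) : bool :=
  [|| (2 * l <= #|fst @: A| + #|snd @: A|)%N, (l < #|fst @: A|)%N | (l < #|snd @: A|)%N].

(** The extreme case is the quasi-square. With a < l = a + u + 1 one has b <= a + 2u + 1, and l (l -
    1) exceeds a (a + 2u + 1) by u^2 + u. *)
Lemma area_le_half_perimeter (a b l : nat) :
  (a + b < 2 * l)%N -> (a * b <= l * (l - 1))%N.
Proof.
wlog al : a b / (a < l)%N => [H|] abl.
  by have [al|al] := ltnP a l; [exact: H | rewrite mulnC H //; lia].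
have [u lE] : exists u, l = (a + u).+1 by exists (l - a.+1)%N; lia.
have bu : (b <= a + u + u.+1)%N by lia.
rewrite (leq_trans (leq_mul (leqnn a) bu)) // lE subn1 /= mulSn !mulnDl !mulnDr.
lia.
Qed.

Lemma card_le_projections (S T : finType) (A : {set S * T}) :
  (#|A| <= #|fst @: A| * #|snd @: A|)%N.
Proof.
rewrite -cardsX subset_leq_card //; apply/subsetP => -[x y] Axy.
by rewrite inE /=; apply/andP; split; apply/imsetP; exists (x, y).
Qed.

Lemma crossing_energy (R : realType) (d : R) K L l (A B : {set 'I_K * 'I_L}) x :
  0 <= d -> 2 <= d * l%:R -> (l.+1 < K)%N -> (l.+1 < L)%N ->
  (forall y, y != x -> (y \in A) = (y \in B)) ->
  ~~ supercritical l A -> supercritical l B ->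
  critical_energy d l <= droplet_energy d (fun y => y \in B).
Proof.
move=> d0 dl lK lL AB nA sB.
(* [supercritical] is monotone, so the change at x must add a site. *)
have xB : x \in B.
  apply: contraNT nA => xB; have BA : B \subset A.
    by apply/subsetP => y yB; rewrite AB //; apply: contraNneq xB => <-.
  have := subset_leq_card (imsetS fst BA); have := subset_leq_card (imsetS snd BA).
  move: sB; rewrite /supercritical.
  by move: #|fst @: A| #|fst @: B| #|snd @: A| #|snd @: B| => a b a2 b2; lia.
have xA : x \notin A.
  apply: contraTN sB => xA; suff -> : B = A by [].
  by apply/setP => y; have [->|yx] := eqVneq y x; rewrite ?xA // AB.
have BE : B = x |: A.
  by apply/setP => y; rewrite !inE; have [->|yx] := eqVneq y x; rewrite //= AB.
have cB : #|B| = #|A|.+1 by rewrite BE cardsU1 xA.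
have cA := card_le_projections A.
have f1 : (#|fst @: B| <= #|fst @: A|.+1)%N by rewrite BE imsetU1 cardsU1; case: (_ \in _).
have f2 : (#|fst @: A| <= #|fst @: B|)%N by rewrite BE imsetU1 subset_leq_card ?subsetUr.
have s1 : (#|snd @: B| <= #|snd @: A|.+1)%N by rewrite BE imsetU1 cardsU1; case: (_ \in _).
have s2 : (#|snd @: A| <= #|snd @: B|)%N by rewrite BE imsetU1 subset_leq_card ?subsetUr.
move: nA sB; rewrite /supercritical; move: f1 f2 s1 s2 cA cB (@disagreements_ge K L B).
rewrite /droplet_energy.
have -> : (\sum_y (y \in B) = #|B|)%N.
  by rewrite -sum1_card [RHS]big_mkcond; apply: eq_bigr => y _; case: (y \in B).
move: (disagreements _) => D.
move: #|fst @: A| #|fst @: B| #|snd @: A| #|snd @: B| #|A| #|B|.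
move=> a' a b' b m n f1 f2 s1 s2 cA cB + nA sB.
have [aK bL] : (a < K)%N /\ (b < L)%N by lia.
move=> /(_ aK bL) DE; rewrite {}cB -natr1 /critical_energy.
have [ab|ab] := leqP (2 * l) (a + b).
  have mN : (m <= l * (l - 1))%N by apply: leq_trans cA (area_le_half_perimeter _); lia.
  have l0 : (0 < l)%N by lia.
  have mR : m%:R <= l%:R * (l%:R - 1) :> R by rewrite -[1]/(1%:R) -natrB // -natrM ler_nat.
  have DR : 4 * l%:R <= D%:R :> R by rewrite -natrM ler_nat; lia.
  have := ler_wpM2l d0 mR; lra.
(* Here a side of B has reached l + 1 while the half-perimeter is still below 2 l; c is the other
   side of A. *)
have [c [cl mN DN]] : exists c, [/\ (c + 2 <= l)%N, (m <= l * c)%N & (2 * (l.+1 + c) <= D)%N].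
  have [al|al] := ltnP l a.
    exists b'; split; [lia| |lia].
    by rewrite (leq_trans cA) // leq_mul2r; lia.
  exists a'; split; [lia| |lia].
  by rewrite (leq_trans cA) // mulnC leq_mul2r; lia.
have cR : c%:R + 2 <= l%:R :> R by rewrite -natrD ler_nat.
have mR : m%:R <= l%:R * c%:R :> R by rewrite -natrM ler_nat.
have DR : 2 * (l%:R + 1 + c%:R) <= D%:R :> R by rewrite natr1 -natrD -natrM ler_nat.
have := ler_wpM2l d0 mR.
(* This product is the surplus of 2 (l + 1 + c) - d (l c + 1) over the critical energy. *)
have : 0 <= (d * l%:R - 2) * (l%:R - 1 - c%:R) by apply: mulr_ge0; lra.
lra.
Qed.

(** Keeping only membership in [c] can only remove disagreements, and [hc] caps the field gain per
    site by d inside the droplet and by 0 outside. *)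
Lemma droplet_energy_le (R : realType) (d : R) K L (h : 'I_3 -> R)
    (sigma : {ffun 'I_K * 'I_L -> 'I_3}) (i : 'I_3) (c : pred 'I_3) :
  (2 < K)%N -> (2 < L)%N -> (forall k, h k - h i <= d * (c k)%:R) ->
  droplet_energy d (fun x => c (sigma x)) <= hamiltonian h sigma - hamiltonian h (mono K L i).
Proof.
move=> K2 L2 hc; rewrite hamiltonian_sub_mono // /droplet_energy.
apply: lerD; last first.
  by rewrite lerN2 natr_sum mulr_sumr; apply: ler_sum => x _; apply: hc.
rewrite ler_nat; apply: leq_sum => x _.
have H y : ((c (sigma x) != c (sigma y)) <= (sigma x != sigma y))%N.
  by case: (eqVneq (sigma x) (sigma y)) => [->|_]; rewrite ?eqxx ?leq_b1.
exact: leq_add.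
Qed.

Lemma energy_barrier_ge (R : realType) (d : R) K L l (h : 'I_3 -> R)
    (i j : 'I_3) (c : pred 'I_3) :
  0 <= d -> 2 <= d * l%:R -> (0 < l)%N -> (l.+1 < K)%N -> (l.+1 < L)%N ->
  (forall k, h k - h i <= d * (c k)%:R) -> ~~ c i -> c j ->
  critical_energy d l <= energy_barrier h (mono K L i) (mono K L j).
Proof.
move=> d0 dl l0 lK lL hc ci cj; rewrite /energy_barrier.
have [[p [pp lp] <-] _] := comm_height_is_min h (mono K L i) (mono K L j).
pose A (s : {ffun 'I_K * 'I_L -> 'I_3}) := [set x | c (s x)].
have K2 : (2 < K)%N by lia. have L2 : (2 < L)%N by lia.
have [||s [t [st ns pt tp]]] := path_crossing (P := fun s => supercritical l (A s)) pp.
- suff -> : A (mono K L i) = set0 by rewrite /supercritical !imset0 !cards0; lia.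
  by apply/setP => x; rewrite !inE ffunE (negbTE ci).
(* The full torus is supercritical because it has K > l columns. *)
- rewrite lp; suff -> : A (mono K L j) = setT.
    rewrite /supercritical; apply/or3P/Or32; suff -> : fst @: [set: 'I_K * 'I_L] = setT.
      by rewrite cardsT card_ord; lia.
    apply/setP => k; rewrite [RHS]inE; apply/imsetP.
    by exists (k, Ordinal (ltnW (ltnW L2))).
  by apply/setP => x; rewrite !inE ffunE cj.
have /cards1P[x xE] := st.
have := @crossing_energy R d K L l (A s) (A t) x d0 dl lK lL _ ns pt.
have -> : droplet_energy d (fun y => y \in A t) = droplet_energy d (fun y => c (t y)).
  congr (droplet_energy d _); apply/boolp.funext => y; by rewrite inE.
have := droplet_energy_le t K2 L2 hc.
have := hamiltonian_le_path_height h (mono K L i) tp.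
move=> h1 h2 h3; have {}h3 := h3 _; apply: le_trans (h3 _) _.
  move=> y yx; rewrite !inE; suff /eqP-> : s y == t y by [].
  by have /setP/(_ y) := xE; rewrite !inE (negbTE yx) => /negbFE.
by apply: le_trans h2 _; rewrite lerD2r.
Qed.

(** * Two-spin configurations and paths below an energy level *)

Definition fill K L (i j : 'I_3) (s : 'I_K * 'I_L -> bool) : {ffun 'I_K * 'I_L -> 'I_3} :=
  [ffun x => if s x then j else i].

Lemma hamiltonian_fill (R : realType) K L (h : 'I_3 -> R) (i j : 'I_3)
    (s : 'I_K * 'I_L -> bool) : (2 < K)%N -> (2 < L)%N -> i != j ->
  hamiltonian h (fill i j s) - hamiltonian h (mono K L i)
    = droplet_energy (h j - h i) s.
Proof.
move=> K2 L2 ij; rewrite hamiltonian_sub_mono //; congr (_ - _).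
  congr (_%:R); apply: eq_bigr => x _.
  have H y : (fill i j s x != fill i j s y) = (s x != s y).
    by rewrite !ffunE; do 2 case: (s _); rewrite ?eqxx // eq_sym.
  by rewrite !H.
rewrite natr_sum mulr_sumr; apply: eq_bigr => x _.
by rewrite ffunE; case: (s x); rewrite ?mulr1 // subrr mulr0.
Qed.

(** Bounding both endpoints makes the relation symmetric, so paths below the level can be
    reversed. *)
Definition low_step (R : realType) K L (h : 'I_3 -> R) (v : R)
    (sigma eta : {ffun 'I_K * 'I_L -> 'I_3}) : bool :=
  [&& config_adj sigma eta, hamiltonian h sigma <= v & hamiltonian h eta <= v].

Lemma low_step_sym (R : realType) K L (h : 'I_3 -> R) (v : R) :
  symmetric (@low_step R K L h v).
Proof.
move=> s t; rewrite /low_step /config_adj.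
have -> : [set x | s x != t x] = [set x | t x != s x].
  by apply/setP => x; rewrite !inE eq_sym.
by rewrite [X in _ && X]andbC.
Qed.

(** The bound on [sigma] covers the path of length zero, about which [low_step] says nothing. *)
Lemma comm_height_le (R : realType) K L (h : 'I_3 -> R) (v : R)
    (sigma eta : {ffun 'I_K * 'I_L -> 'I_3}) :
  hamiltonian h sigma <= v -> connect (low_step h v) sigma eta ->
  comm_height h sigma eta <= v.
Proof.
move=> sv /connectP[p pp lp].
have [_ H] := comm_height_is_min h sigma eta; apply: le_trans (H p _) _.
  by split=> //; apply: sub_path pp => s t /and3P[].
have : all (fun s => hamiltonian h s <= v) p.
  by elim: p {lp H} sigma sv pp => //= t p IH s sv /andP[/and3P[_ _ tv] tp]; rewrite tv (IH t).
rewrite /path_height => /allP pv; rewrite big_seq.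
exact: bigmax_le.
Qed.

Lemma connect_low_step (R : realType) K L (h : 'I_3 -> R) (v : R)
    (sigma eta : {ffun 'I_K * 'I_L -> 'I_3}) :
  comm_height h sigma eta <= v -> connect (low_step h v) sigma eta.
Proof.
have [[p [pp lp] <-] _] := comm_height_is_min h sigma eta => pv.
have sv : hamiltonian h sigma <= v.
  apply: le_trans pv; rewrite /path_height; elim: p {pp lp} => [|t p IH]; first by rewrite big_nil.
  by rewrite big_cons le_max IH orbT.
have {}pv t : t \in p -> hamiltonian h t <= v.
  by move=> /hamiltonian_le_path_height tp; apply: le_trans (tp _ _ _) pv.
apply/connectP; exists p => //.
elim: p sigma sv pp lp pv => //= t p IH s sv /andP[st tp] lp pv.
have tv : hamiltonian h t <= v by apply: pv; rewrite mem_head.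
rewrite /low_step st sv tv /=; apply: IH => // u up.
by apply: pv; rewrite in_cons up orbT.
Qed.

Lemma connect_fill_chain (R : realType) K L (h : 'I_3 -> R) (v : R) (i j : 'I_3) n
    (s : nat -> 'I_K * 'I_L -> bool) :
  (2 < K)%N -> (2 < L)%N -> i != j ->
  (forall c, (c <= n)%N -> droplet_energy (h j - h i) (s c) <= v) ->
  (forall c, (c < n)%N -> exists x, forall y, (s c y != s c.+1 y) = (y == x)) ->
  connect (low_step h (hamiltonian h (mono K L i) + v)) (fill i j (s 0)) (fill i j (s n)).
Proof.
move=> K2 L2 ij; elim: n => [|n IH] sv sS; first exact: connect0.
apply: connect_trans (IH _ _) (connect1 _).
- by move=> c cn; apply: sv; apply: leqW.
- by move=> c cn; apply: sS; apply: leqW.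
have Hv c : (c <= n.+1)%N -> hamiltonian h (fill i j (s c)) <= hamiltonian h (mono K L i) + v.
  by move=> /sv; rewrite -hamiltonian_fill // lerBlDl.
rewrite /low_step !Hv // !andbT /config_adj; have [x xE] := sS n (ltnSn n).
apply/cards1P; exists x; apply/setP => y; rewrite !inE -xE !ffunE.
by do 2 case: (s _ _); rewrite ?eqxx // eq_sym.
Qed.

(** * Growing a box by one column or one row *)

Definition box K L (a b : nat) (x : 'I_K * 'I_L) : bool := ((x.1 < a) && (x.2 < b))%N.

Definition box_with_column K L (a b c : nat) (x : 'I_K * 'I_L) : bool :=
  ((x.1 < a) && (x.2 < b) || (x.1 == a :> nat) && (x.2 < c))%N.

(* The energy of an [a * b] box that does not wrap around the torus; for a wrapping box
   it is only an upper bound. *)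
Definition box_energy (R : realType) (d : R) (a b : nat) : R :=
  2 * (a%:R + b%:R) - d * (a%:R * b%:R).

Lemma box_with_column_size K L a b c : (a < K)%N -> (c <= b <= L)%N ->
  (\sum_x @box_with_column K L a b c x = a * b + c)%N.
Proof.
move=> aK /andP[cb bL].
have -> : (\sum_x @box_with_column K L a b c x =
  \sum_(i < K) \sum_(j < L) @box_with_column K L a b c (i, j))%N.
  by rewrite pair_bigA; apply: eq_bigr; case.
transitivity (\sum_(i < K) ((i < a) * b + (i == a :> nat) * c))%N.
  apply: eq_bigr => i _.
  transitivity (\sum_(j < L) (j < (i < a) * b + (i == a :> nat) * c))%N; last first.
    by rewrite sum_ltn_ord; case: ltngtP => _ /=; lia.
  by apply: eq_bigr => j _; rewrite /box_with_column /=; case: ltngtP => _ /=; lia.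
rewrite big_split /= -!big_distrl /= sum_ltn_ord; congr (_ * _ + _)%N; first by lia.
rewrite (bigD1 (Ordinal aK)) //= eqxx big1 ?addn0 ?mul1n // => i.
by rewrite -val_eqE /= => /negbTE ->.
Qed.

Lemma box_with_column_disagreements K L a b c : (c <= b)%N ->
  (disagreements (@box_with_column K L a b c) <= 2 * (a + (0 < c) + b))%N.
Proof.
move=> cb.
pose f i := ((i < a) * b + (i == a :> nat) * c)%N.
pose g j := (if j < c then a.+1 else if j < b then a else 0)%N.
apply: (@disagreements_staircase_le _ _ _ f g).
- by move=> [i j]; rewrite /box_with_column /f /=; case: ltngtP => _ /=; lia.
- move=> [i j]; rewrite /box_with_column /g /=.
  by have [jc|jc] := ltnP j c; have [jb|jb] := ltnP j b; lia.
- by move=> i; rewrite /f; lia.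
- by move=> j; rewrite /g; have [jc|jc] := ltnP j c; have [jb|jb] := ltnP j b; lia.
Qed.

(** The worst case is c = 1: the first site of a new column costs 2 - d, and each later one gains d
    at no cost in the perimeter bound. *)
Lemma box_with_column_energy (R : realType) (d v : R) K L a b c :
  0 <= d <= 2 -> (a < K)%N -> (c <= b <= L)%N -> box_energy d a b + (2 - d) <= v ->
  droplet_energy d (@box_with_column K L a b c) <= v.
Proof.
move=> /andP[d0 d2] aK cbL; rewrite /box_energy /droplet_energy box_with_column_size // => ev.
case/andP: cbL => cb bL; have := @box_with_column_disagreements K L a b c cb.
rewrite -(ler_nat R) natrM !natrD natrM; case: c cb => [|c] cb /=; first by lra.
rewrite -natr1 => H; have : 0 <= d * c%:R by rewrite mulr_ge0.
lra.
Qed.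

Lemma disagreements_swap (T : eqType) K L (s : 'I_L * 'I_K -> T) :
  disagreements (fun x : 'I_K * 'I_L => s (x.2, x.1)) = disagreements s.
Proof. by rewrite !disagreementsE addnC. Qed.

Lemma droplet_energy_swap (R : realType) (d : R) K L (s : 'I_L * 'I_K -> bool) :
  droplet_energy d (fun x : 'I_K * 'I_L => s (x.2, x.1)) = droplet_energy d s.
Proof.
rewrite /droplet_energy disagreements_swap; congr (_ - _ * _%:R).
by rewrite -(pair_bigA _ (fun i j => nat_of_bool (s (j, i)))) exchange_big pair_bigA;
  apply: eq_bigr; case.
Qed.

Lemma box_with_column_step K L a b c : (a < K)%N -> (c < b <= L)%N ->
  exists x, forall y, (@box_with_column K L a b c y != box_with_column a b c.+1 y) = (y == x).
Proof.
move=> aK /andP[cb bL]; have cL : (c < L)%N by lia.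
exists (Ordinal aK, Ordinal cL) => -[i j]; rewrite xpair_eqE -!val_eqE /box_with_column /=.
case: ltngtP => _ /=; lia.
Qed.

Lemma box_with_column0 K L a b : @box_with_column K L a b 0 =1 box a b.
Proof. by move=> x; rewrite /box_with_column /box; lia. Qed.

Lemma box_with_column_full K L a b : @box_with_column K L a b b =1 box a.+1 b.
Proof. by move=> x; rewrite /box_with_column /box; lia. Qed.

Lemma eq_fill K L i j (s t : 'I_K * 'I_L -> bool) : s =1 t -> fill i j s = fill i j t.
Proof. by move=> st; apply/ffunP => x; rewrite !ffunE st. Qed.

Lemma connect_box_column (R : realType) K L (h : 'I_3 -> R) (v : R) (i j : 'I_3) a b :
  (2 < K)%N -> (2 < L)%N -> i != j -> 0 <= h j - h i <= 2 -> (a < K)%N -> (b <= L)%N ->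
  box_energy (h j - h i) a b + (2 - (h j - h i)) <= v ->
  connect (low_step h (hamiltonian h (mono K L i) + v))
    (fill i j (@box K L a b)) (fill i j (box a.+1 b)).
Proof.
move=> K2 L2 ij d02 aK bL ev.
rewrite -(eq_fill i j (@box_with_column0 K L a b)) -(eq_fill i j (@box_with_column_full K L a b)).
apply: connect_fill_chain => // c cb.
  by apply: box_with_column_energy => //; rewrite cb.
by apply: box_with_column_step => //; rewrite cb.
Qed.

(** A row is a column of the transposed torus. *)
Lemma connect_box_row (R : realType) K L (h : 'I_3 -> R) (v : R) (i j : 'I_3) a b :
  (2 < K)%N -> (2 < L)%N -> i != j -> 0 <= h j - h i <= 2 -> (a <= K)%N -> (b < L)%N ->
  box_energy (h j - h i) a b + (2 - (h j - h i)) <= v ->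
  connect (low_step h (hamiltonian h (mono K L i) + v))
    (fill i j (@box K L a b)) (fill i j (box a b.+1)).
Proof.
move=> K2 L2 ij d02 aK bL ev.
pose s c (x : 'I_K * 'I_L) := @box_with_column L K b a c (x.2, x.1).
have -> : fill i j (@box K L a b) = fill i j (s 0).
  by apply: eq_fill => x; rewrite /s box_with_column0 /box andbC.
have -> : fill i j (@box K L a b.+1) = fill i j (s a).
  by apply: eq_fill => x; rewrite /s box_with_column_full /box andbC.
apply: connect_fill_chain => // c ca.
  rewrite droplet_energy_swap; apply: box_with_column_energy => //; first by rewrite ca.
  by move: ev; rewrite /box_energy; lra.
have [|x xE] := @box_with_column_step L K b a c bL; first by rewrite ca.
by exists (x.2, x.1) => -[y z]; rewrite xE; case: x {xE} => ? ?; rewrite !xpair_eqE andbC.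
Qed.

(** * Energy estimates along the growth, and the upper bound *)

Lemma quasi_square_energy_le (R : realType) (d : R) k l :
  0 <= d -> 2 <= d * l%:R -> d * (l%:R - 1) <= 2 -> (k < l)%N ->
  box_energy d k k.+1 + (2 - d) <= critical_energy d l.
Proof.
move=> d0 dl dl1; rewrite leq_eqVlt => /orP[/eqP kl|].
  (* For k = l - 1 the two sides are equal: this is the critical droplet. *)
  by rewrite -kl /box_energy /critical_energy -natr1; lra.
move=> kl; rewrite /box_energy /critical_energy -natr1.
have kR : k%:R + 2 <= l%:R :> R by rewrite -natrD ler_nat; lia.
have k0 : 0 <= k%:R :> R by [].
have : d * (l%:R + k%:R) <= 4.
  by have := ler_wpM2l d0 kR; lra.
(* The gap between the two sides factors into this product. *)
move=> H; have : 0 <= (l%:R - 1 - k%:R) * (4 - d * (l%:R + k%:R)) by apply: mulr_ge0; lra.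
lra.
Qed.

(** Enlarging the k x k box to k x (k + 1) changes the energy by 2 - d k, which is nonnegative for k
    < l. *)
Lemma square_energy_le (R : realType) (d : R) k l :
  0 <= d -> 2 <= d * l%:R -> d * (l%:R - 1) <= 2 -> (k < l)%N ->
  box_energy d k k + (2 - d) <= critical_energy d l.
Proof.
move=> d0 dl dl1 kl; apply: le_trans (quasi_square_energy_le d0 dl dl1 kl).
have kR : k%:R + 1 <= l%:R :> R by rewrite natr1 ler_nat.
rewrite /box_energy -natr1; have := ler_wpM2l d0 kR; lra.
Qed.

(** Compare with the l x (l - 1) box, where equality holds. Growing the second side to b adds (b + 1
    - l) (2 - d l) <= 0; growing the first to a then adds (a - l) (2 - d b), whose sign needs a = l
    or b >= l. *)
Lemma large_box_energy_le (R : realType) (d : R) a b l :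
  0 <= d -> 2 <= d * l%:R -> (l <= a)%N -> (l <= b.+1)%N -> (a == l) || (l <= b)%N ->
  box_energy d a b + (2 - d) <= critical_energy d l.
Proof.
move=> d0 dl la lb H; rewrite /box_energy /critical_energy.
have laR : l%:R <= a%:R :> R by rewrite ler_nat.
have lbR : l%:R <= b%:R + 1 :> R by rewrite natr1 ler_nat.
have : 0 <= (b%:R + 1 - l%:R) * (d * l%:R - 2) by apply: mulr_ge0; lra.
case/orP: H => [/eqP->|lb']; first by lra.
have lbR' : l%:R <= b%:R :> R by rewrite ler_nat.
have : 0 <= (a%:R - l%:R) * (d * b%:R - 2).
  by apply: mulr_ge0; first lra; have := ler_wpM2l d0 lbR'; lra.
lra.
Qed.

Lemma connect_mono (R : realType) K L l (h : 'I_3 -> R) (i j : 'I_3) :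
  let d := h j - h i in
  0 < d < 1 -> 2 <= d * l%:R -> d * (l%:R - 1) < 2 -> i != j ->
  (0 < l)%N -> (l.+1 < K)%N -> (l.+1 < L)%N ->
  connect (low_step h (hamiltonian h (mono K L i) + critical_energy d l))
    (mono K L i) (mono K L j).
Proof.
move=> d /andP[/ltW d0 d1] dl /ltW dl1 ij l0 lK1 lL1.
have d02 : 0 <= d <= 2 by rewrite d0; lra.
have K2 : (2 < K)%N by lia. have L2 : (2 < L)%N by lia.
have lK : (l <= K)%N by lia. have lL : (l <= L)%N by lia.
have col a b aK bL := @connect_box_column R K L h (critical_energy d l) i j a b K2 L2 ij d02 aK bL.
have row a b aK bL := @connect_box_row R K L h (critical_energy d l) i j a b K2 L2 ij d02 aK bL.
(* Each round adds a column and then a row; the starting 0 x 1 box is empty. *)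
have squares k : (k < l)%N ->
  connect (low_step h (hamiltonian h (mono K L i) + critical_energy d l))
    (fill i j (@box K L 0 1)) (fill i j (box k k.+1)).
  elim: k => // k IH kl; apply: connect_trans (IH (ltnW kl)) _.
  apply: connect_trans (col k k.+1 _ _ (quasi_square_energy_le d0 dl dl1 (ltnW kl))) _; try lia.
  by apply: row (square_energy_le d0 dl dl1 kl); lia.
have -> : mono K L i = fill i j (@box K L 0 1) by apply/ffunP => x; rewrite !ffunE.
have -> : mono K L j = fill i j (@box K L K L).
  by apply/ffunP => x; rewrite !ffunE /box !ltn_ord.
have l1 : (l.-1 < l)%N by lia.
apply: connect_trans (squares _ l1) _.
apply: connect_trans (col _ _ _ _ (quasi_square_energy_le d0 dl dl1 l1)) _; try lia.
rewrite prednK //.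
have rows b : (l + b <= L)%N ->
  connect (low_step h (hamiltonian h (mono K L i) + critical_energy d l))
    (fill i j (@box K L l l)) (fill i j (box l (l + b))).
  elim: b => [|b IH] lb; first by rewrite addn0.
  rewrite addnS; apply: connect_trans (IH _) _; first by lia.
  by apply: row; rewrite ?large_box_energy_le ?eqxx //; lia.
have cols a : (l + a <= K)%N ->
  connect (low_step h (hamiltonian h (mono K L i) + critical_energy d l))
    (fill i j (@box K L l L)) (fill i j (box (l + a) L)).
  elim: a => [|a IH] la; first by rewrite addn0.
  rewrite addnS; apply: connect_trans (IH _) _; first by lia.
  by apply: col; rewrite ?large_box_energy_le ?lL ?orbT //; lia.
have := rows (L - l)%N; have := cols (K - l)%N; rewrite !subnKC // => cKK cLL.
exact: connect_trans (cLL _) (cKK _).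
Qed.

(** * The critical length and numerical consequences of assumption (A) *)

(** The two inequalities characterize l = ceil (2 / d) and are all that is used about the ceiling
    afterwards. *)
Lemma crit_length_nat (R : realType) (d : R) : 0 < d ->
  exists l : nat, [/\ crit_energy d = critical_energy d l, 2 <= d * l%:R & d * (l%:R - 1) < 2].
Proof.
move=> d0; have c0 : 0 <= crit_length d.
  by rewrite -(ler_int R) (le_trans _ (Num.Theory.ceil_ge _)) // divr_ge0 // ltW.
have lE : (crit_length d)%:~R = `|crit_length d|%N%:R :> R by rewrite -[in LHS](gez0_abs c0).
exists `|crit_length d|%N; rewrite /critical_energy -lE; split=> //.
  by rewrite mulrC -ler_pdivrMr // ceil_ge.
by rewrite mulrC -ltr_pdivlMr // -[X in _ - X]/(1%:~R) -intrB ceilB1_lt.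
Qed.

(** If d <= 1/2 then d (l + 1) < 2 + 2 d <= 3 < d n. If d > 1/2 then l <= 4, and n > 6 suffices. *)
Lemma critical_length_lt (R : realType) (d : R) (l n : nat) :
  0 < d < 1 -> d * (l%:R - 1) < 2 -> 3 / d < n%:R -> (6 < n)%N -> (l.+1 < n)%N.
Proof.
move=> /andP[d0 d1] dl; rewrite ltr_pdivrMr // => dn n6.
have [d2|d2] := lerP d (1 / 2).
  have : d * (l%:R + 1) < d * n%:R by lra.
  by rewrite ltr_pM2l // natr1 ltr_nat.
suff : (l < 5)%N by lia.
rewrite -(ltr_nat R) ltNge; apply/negP => l5.
have := ler_wpM2l (ltW d0) l5; lra.
Qed.

Lemma hamiltonian_mono_sub (R : realType) K L (h : 'I_3 -> R) (i j : 'I_3) :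
  (2 < K)%N -> (2 < L)%N ->
  hamiltonian h (mono K L j) - hamiltonian h (mono K L i) = - ((h j - h i) * (K * L)%:R).
Proof.
move=> K2 L2; rewrite hamiltonian_sub_mono //.
have -> : disagreements (mono K L j) = 0%N.
  by rewrite /disagreements big1 // => x _; rewrite !ffunE eqxx.
rewrite (eq_bigr (fun=> h j - h i)) => [|x _]; last by rewrite ffunE.
by rewrite sumr_const card_prod !card_ord sub0r mulr_natr.
Qed.

(** The constant 9 is what (A) can pay for: it yields d12 K > 3 and L > 3 / d23, hence d12 K L > 9 /
    d23. *)
Lemma critical_energy_bounds (R : realType) (d : R) (l : nat) :
  0 < d < 1 -> 2 <= d * l%:R -> d * (l%:R - 1) < 2 -> 0 < critical_energy d l <= 9 / d.
Proof.
move=> /andP[d0 d1] dl dl1; have l0 : (0 < l)%N by case: l dl dl1 => //; rewrite mulr0; lra.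
have l1 : 1 <= l%:R :> R by rewrite (ler_nat _ 1).
rewrite ler_pdivlMr // /critical_energy; set x : R := l%:R in dl dl1 l1 *.
apply/andP; split; first by have := ler_wpM2r (ler0n R l) (ltW dl1); rewrite -/x; lra.
have : 0 <= (d * x - 2) * (d * (x - 1)).
  by apply: mulr_ge0; last apply: mulr_ge0; lra.
have : 0 <= d * d by apply: mulr_ge0; lra.
lra.
Qed.

Theorem theorem2p1 (R : realType) (K L : nat) (h : 'I_3 -> R)
    (hK : (0 < K)%N) (hL : (0 < L)%N)
    (h1_gt0 : 0 < h spin1) (h12 : h spin1 < h spin2)
    (h23 : h spin2 < h spin3) (h3_lt1 : h spin3 < 1)
    (hA_K : 3 / (h spin3 - h spin2) < K%:R /\ 3 / (h spin2 - h spin1) < K%:R)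
    (hA_L : 3 / (h spin3 - h spin2) < L%:R /\ 3 / (h spin2 - h spin1) < L%:R)
    (hB : forall a b : int, (a, b) <> (0, 0) ->
       a%:~R * (h spin2 - h spin1) + b%:~R * (h spin3 - h spin2)
         \isn't a Num.int) :
  energy_barrier h (mono K L spin1) (mono K L spin3) = Gamma_star h spin1 spin3
  /\ energy_barrier h (mono K L spin1) (mono K L spin2) = Gamma_star h spin1 spin3
  /\ energy_barrier h (mono K L spin2) (mono K L spin3) = Gamma_star h spin2 spin3.
Proof.
case: hA_K hA_L => [K23 K12] [L23 L12]; clear hB.
set d12 := h spin2 - h spin1 in K12 L12; set d23 := h spin3 - h spin2 in K23 L23.
pose d13 := h spin3 - h spin1.
have d12_gt0 : 0 < d12 by rewrite subr_gt0.
have d23_gt0 : 0 < d23 by rewrite subr_gt0.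
have d13E : d13 = d12 + d23 by rewrite /d13 /d12 /d23; ring.
have d13_lt1 : d13 < 1 by rewrite /d13; lra.
(* Adding the two bounds gives 6 < n (d12 + d23) < n. *)
have gt6 n : 3 / d23 < n%:R -> 3 / d12 < n%:R -> (6 < n)%N.
  rewrite !ltr_pdivrMr // => H1 H2; rewrite -(ltr_nat R) ltNge; apply/negP => n6.
  have := ler_wpM2l (ltW d12_gt0) n6; have := ler_wpM2l (ltW d23_gt0) n6; lra.
have [K6 L6] := (gt6 _ K23 K12, gt6 _ L23 L12).
have [K2 L2] : (2 < K)%N /\ (2 < L)%N by split; [apply: leq_trans K6|apply: leq_trans L6].
have d13_gt n : 3 / d23 < n%:R -> 3 / d13 < n%:R.
  by apply: le_lt_trans; rewrite ler_pM2l // lef_pV2 ?posrE; lra.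
have hd13 : 0 < d13 < 1 by apply/andP; split; lra.
have hd23 : 0 < d23 < 1 by apply/andP; split; lra.
have [l [GE dl dl1]] := crit_length_nat (proj1 (andP hd13)).
have [m [G23E dm dm1]] := crit_length_nat d23_gt0.
have lK := critical_length_lt hd13 dl1 (d13_gt _ K23) K6.
have lL := critical_length_lt hd13 dl1 (d13_gt _ L23) L6.
have mK := critical_length_lt hd23 dm1 K23 K6.
have mL := critical_length_lt hd23 dm1 L23 L6.
have pos (d : R) (k : nat) : 2 <= d * k%:R -> (0 < k)%N.
  by case: k => // ; rewrite mulr0; lra.
have [l0 m0] := (pos _ _ dl, pos _ _ dm).
have spinP (k : 'I_3) : [\/ k = spin1, k = spin2 | k = spin3].
  case: k => [[|[|[|//]]]] k3; [apply: Or31|apply: Or32|apply: Or33]; exact: val_inj.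
rewrite /Gamma_star -/d13 -/d23 GE G23E.
have low1 j : j != spin1 -> critical_energy d13 l <= energy_barrier h (mono K L spin1) (mono K L j).
  (* Spins 2 and 3 are merged; each gains at most d13 over spin 1. *)
  move=> j1; apply: (@energy_barrier_ge _ _ _ _ _ _ _ _ (fun k => k != spin1)) => //; first lra.
  by move=> k; case: (spinP k) => -> /=; rewrite ?mulr1 ?mulr0 /d13; lra.
have low23 : critical_energy d23 m <= energy_barrier h (mono K L spin2) (mono K L spin3).
  (* Spins 1 and 2 are merged into the sea, as spin 1 gains nothing over spin 2. *)
  apply: (@energy_barrier_ge _ _ _ _ _ _ _ _ (fun k => k == spin3)) => //; first lra.
  by move=> k; case: (spinP k) => -> /=; rewrite ?mulr1 ?mulr0 /d23; lra.
have up j v : comm_height h (mono K L spin1) (mono K L j) <= hamiltonian h (mono K L spin1) + v ->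
  energy_barrier h (mono K L spin1) (mono K L j) <= v by rewrite /energy_barrier; lra.
have /andP[crit13_gt0 _] := critical_energy_bounds hd13 dl dl1.
have /andP[crit23_gt0 crit9] := critical_energy_bounds hd23 dm dm1.
have con13 : connect (low_step h (hamiltonian h (mono K L spin1) + critical_energy d13 l))
    (mono K L spin1) (mono K L spin3) by exact: connect_mono.
have con23 : connect (low_step h (hamiltonian h (mono K L spin2) + critical_energy d23 m))
    (mono K L spin2) (mono K L spin3) by exact: connect_mono.
have h23_le : comm_height h (mono K L spin2) (mono K L spin3)
    <= hamiltonian h (mono K L spin2) + critical_energy d23 m.
  by apply: comm_height_le con23; rewrite lerDl ltW.
have h13_le : comm_height h (mono K L spin1) (mono K L spin3)
    <= hamiltonian h (mono K L spin1) + critical_energy d13 l.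
  by apply: comm_height_le con13; rewrite lerDl ltW.
(* The basin of spin 2 is so deep that leaving it costs less than the first nucleation. *)
have descent : hamiltonian h (mono K L spin2) + critical_energy d23 m
    <= hamiltonian h (mono K L spin1).
  have := hamiltonian_mono_sub h spin1 spin2 K2 L2; rewrite -/d12 => H.
  suff : critical_energy d23 m <= d12 * (K * L)%:R by lra.
  apply: le_trans crit9 _; rewrite natrM mulrA.
  have -> : 9 / d23 = 3 * (3 / d23) by lra.
  apply: ler_pM => //; first by rewrite divr_ge0 //; lra.
    by move: K12; rewrite ltr_pdivrMr //; lra.
  exact: ltW.
split; first by apply/eqP; rewrite eq_le low1 // up.
split; last first.
  by apply/eqP; rewrite eq_le low23 andbT /energy_barrier; lra.
apply/eqP; rewrite eq_le low1 // andbT up //; apply: comm_height_le; first lra.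
apply: connect_trans con13 _.
(* The optimal path from 2 to 3 is run backwards; by [descent] its height is at most the energy of
   1. *)
rewrite (sym_connect_sym (@low_step_sym R K L h _)); apply: connect_low_step.
by apply: le_trans h23_le _; lra.
Qed.
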